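(* Let $\alpha \ge 1$. Suppose $\mathsf{A}_\alpha$ is an $\alpha$-competitive algorithm for the semi-online machine minimization problem (preemptive, respectively non-preemptive). Then the algorithm Double, using $\mathsf{A}_\alpha$ as subroutine, is a $4\alpha$-competitive algorithm for the online machine minimization problem (preemptive, respectively non-preemptive).
   Context: Machine minimization with deadlines: an instance is a finite set $J$ of jobs; each job $j$ has a release date $r_j$, processing time $p_j$ and deadline $d_j$ (nonnegative integers). A feasible schedule on a number of identical machines processes each job for $p_j$ time units within $[r_j,d_j]$; each machine processes at most one job at a time and no job runs on two machines simultaneously. In the preemptive variant jobs may be interrupted at any time and resumed later on any machine; in the non-preemptive variant a job runs uninterrupted on one machine once started. For a job set $J$, $m(J)$ is the minimum number of machines admitting a feasible schedule (for the respective variant), and $m=m(J)$ for the whole instance. Online problem: each job becomes known only at its release date, and the algorithm makes its (irrevocable) decisions over time. Semi-online problem: as online, but the optimal value $m$ is given to the algorithm in advance. An algorithm is $c$-competitive if on every instance it produces a feasible schedule using at most $c\cdot m$ machines. Let $J(t)=\{j\in J: r_j\le t\}$ and $m(t)=m(J(t))$. Algorithm Double: let $t_0=\min_j r_j$ and for $i=1,2,\dots$ let $t_i=\min\{t: m(t)>2m(t_{i-1})\}$. At each time $t_i$, open $2\alpha m(t_i)$ new machines; all jobs with $r_j\in[t_{i},t_{i+1})$ are scheduled by $\mathsf{A}_\alpha$ (given the value $2m(t_{i})$ in place of the optimum) exclusively on the machines opened at time $t_{i}$. *)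

(* Defs.v *)
From HB Require Import structures.
From mathcomp Require Import all_boot all_order all_algebra finmap.
From mathcomp Require Import all_classical all_reals all_analysis.

Set Implicit Arguments.
Unset Strict Implicit.
Unset Printing Implicit Defensive.

Import Order.TTheory GRing.Theory Num.Theory.

Local Open Scope classical_set_scope.
Local Open Scope fset_scope.
Local Open Scope ring_scope.

(* The identifier allows several jobs with the same numerical data. *)
Record job := Job {
  job_id : nat;
  release : nat;
  processing : nat;
  deadline : nat }.

Definition tuple_of_job (j : job) : nat * nat * nat * nat :=
  (job_id j, release j, processing j, deadline j).

Definition job_of_tuple (x : nat * nat * nat * nat) : job :=
  let: (n, r, p, d) := x in Job n r p d.

Lemma tuple_of_jobK : cancel tuple_of_job job_of_tuple.
Proof. by case. Qed.

HB.instance Definition _ := Countable.copy job (can_type tuple_of_jobK).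

Inductive variant := Preemptive | NonPreemptive.

(* Time is continuous.  [S t] lists, machine by machine, what the machines open
   at time [t] are doing: entry [i] is [Some j] if machine [i] is processing job
   [j] at time [t], and [None] if it is idle.  Machines are numbered in the
   order in which they are opened, so that a schedule with [size (S t) <= k] for
   all [t] uses at most [k] machines in total. *)
Definition schedule (R : realType) := R -> seq (option job).

Definition runs (R : realType) (S : schedule R) (j : job) (i : nat) : set R :=
  [set t | nth None (S t) i = Some j].

Definition preemptively_processed (R : realType) (S : schedule R) (j : job) :
    Prop :=
  (forall i, measurable (runs S j i)) /\
  lebesgue_measure [set t | Some j \in S t] = ((processing j)%:R : R)%:E.

(* Half-open intervals let a machine switch from one job directly to another. *)
Definition nonpreemptively_processed (R : realType) (S : schedule R) (j : job) :
    Prop :=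
  exists (i : nat) (s : R),
    runs S j i = `[s, s + (processing j)%:R[%classic /\
    forall i', i' != i -> runs S j i' = set0.

Definition processed (R : realType) (v : variant) (S : schedule R) (j : job) :
    Prop :=
  match v with
  | Preemptive => preemptively_processed S j
  | NonPreemptive => nonpreemptively_processed S j
  end.

Definition feasible (R : realType) (v : variant) (J : {fset job})
    (S : schedule R) : Prop :=
  [/\ forall t i j, runs S j i t ->
        [/\ j \in J, (release j)%:R <= t & t <= (deadline j)%:R],
      forall t i i' j, runs S j i t -> runs S j i' t -> i = i'
    & forall j, j \in J -> processed v S j].

Definition schedulable (R : realType) (v : variant) (J : {fset job})
    (k : nat) : Prop :=
  exists2 S : schedule R, feasible v J S & forall t, (size (S t) <= k)%N.

Definition least (P : pred nat) : option nat :=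
  if pselect (exists n, P n) is left exP then Some (ex_minn exP) else None.

(* The value is meaningful only if [J] is schedulable on some number of machines;
   otherwise it is 0. *)
Definition opt (R : realType) (v : variant) (J : {fset job}) : nat :=
  odflt 0%N (least (fun k => `[< schedulable R v J k >])).

Definition visible (R : realType) (J : {fset job}) (t : R) : {fset job} :=
  [fset j in J | (release j)%:R <= t].

(* A deterministic online algorithm: the decision at time [t] is a function of
   [t] and of the set of jobs released up to time [t] (which also determines all
   the earlier decisions). *)
Definition algorithm (R : realType) := {fset job} -> R -> seq (option job).

Definition run (R : realType) (A : algorithm R) (J : {fset job}) : schedule R :=
  fun t => A (visible J t) t.

Definition succeeds (R : realType) (v : variant) (c : R) (A : algorithm R)
    (J : {fset job}) : Prop :=
  feasible v J (run A J) /\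
  forall t, (size (run A J t))%:R <= c * (opt R v J)%:R.

(* Instances are the job sets for which the optimum exists. *)
Definition online_competitive (R : realType) (v : variant) (c : R)
    (A : algorithm R) : Prop :=
  forall J : {fset job}, (exists k, schedulable R v J k) -> succeeds v c A J.

Definition semi_online_competitive (R : realType) (v : variant) (c : R)
    (A : nat -> algorithm R) : Prop :=
  forall J : {fset job}, (exists k, schedulable R v J k) ->
    succeeds v c (A (opt R v J)) J.

Definition opt_at (R : realType) (v : variant) (J : {fset job}) (s : nat) : nat :=
  opt R v (visible J (s%:R : R)).

(* The times t_0, t_1, ..., with [None] when there is no such time.  Searching
   over natural numbers is enough: [visible J] changes only at release dates. *)
Fixpoint restart (R : realType) (v : variant) (J : {fset job}) (i : nat) :
    option nat :=
  match i with
  | 0%N => least (fun t => t \in [fset release j | j in J])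
  | i'.+1 =>
      if restart R v J i' is Some s
      then least (fun t => (2 * opt_at R v J s < opt_at R v J t)%N)
      else None
  end.

Definition phase_jobs (R : realType) (v : variant) (J : {fset job}) (i : nat) :
    {fset job} :=
  if restart R v J i is Some s then
    [fset j in J | (s <= release j)%N &&
       (if restart R v J i.+1 is Some s' then (release j < s')%N else true)]
  else fset0.

(* What the machines opened at the [i]-th restart do at time [t], when [K] is the
   set of jobs released so far.  The number of machines opened is 2 alpha m(t_i),
   rounded down. *)
Definition phase_machines (R : realType) (v : variant) (alpha : R)
    (A : nat -> algorithm R) (K : {fset job}) (t : R) (i : nat) :
    seq (option job) :=
  if restart R v K i is Some s then
    let M := (2 * opt_at R v K s)%N in
    mkseq (nth None (A M (phase_jobs R v K i) t)) (Num.truncn (alpha * M%:R))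
  else [::].

(* Restarts happen at distinct release dates, so [K] induces at most [#|` K|] of
   them; the ones up to the current time are determined by [K]. *)
Definition Double (R : realType) (v : variant) (alpha : R)
    (A : nat -> algorithm R) : algorithm R :=
  fun K t => flatten (mkseq (phase_machines v alpha A K t) #|` K|).

(* Main.v *)
Require Import Defs.
From mathcomp Require Import all_boot all_order all_algebra.
From mathcomp Require Import all_reals.
From mathcomp Require Import finmap all_classical all_analysis.
From mathcomp Require Import zify.

(* The jobs of phase [i] form a subset of the jobs visible just before
   [t_(i+1)], so their optimum is at most [2 m(t_i)] and the subroutine schedules
   them on the [2 alpha m(t_i)] machines of that phase. The phases partition the
   instance, and their machines are disjoint. Since [m(t_(i+1)) > 2 m(t_i)], the
   sum of the [m(t_i)] is at most twice the last one, hence at most [2 m].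

   The subroutine is told [2 m(t_i)], which may exceed the optimum of its jobs,
   whereas the hypothesis only speaks about the exact optimum. This is bridged by
   padding with unit jobs released so late that they cannot influence anything
   before all deadlines of the phase have passed. *)

Set Implicit Arguments.
Unset Strict Implicit.
Unset Printing Implicit Defensive.

Import Order.TTheory GRing.Theory Num.Theory.

Local Open Scope classical_set_scope.
Local Open Scope fset_scope.
Local Open Scope ring_scope.

(** * Least naturals and visible job sets *)

Variant least_spec (P : pred nat) : option nat -> Prop :=
| LeastSome n of P n & (forall m, P m -> (n <= m)%N) : least_spec P (Some n)
| LeastNone of (forall m, ~~ P m) : least_spec P None.

Lemma leastP (P : pred nat) : least_spec P (least P).
Proof.
rewrite /least; case: pselect => [exP|nexP].
  by case: ex_minnP => n Pn minn; exact: LeastSome.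
by apply: LeastNone => m; apply/negP => Pm; apply: nexP; exists m.
Qed.

Lemma least_eq (P : pred nat) (n : nat) :
  P n -> (forall m, P m -> (n <= m)%N) -> least P = Some n.
Proof.
move=> Pn minn; case: leastP => [k Pk mink|/(_ n)]; last by rewrite Pn.
by congr Some; apply/eqP; rewrite eqn_leq mink //= minn.
Qed.

Lemma least_none (P : pred nat) : (forall m, ~~ P m) -> least P = None.
Proof. by move=> nP; case: leastP => // k Pk; rewrite (negbTE (nP k)) in Pk. Qed.

Lemma mem_visible (R : realType) (J : {fset job}) (t : R) (j : job) :
  (j \in visible J t) = (j \in J) && ((release j)%:R <= t).
Proof. by rewrite /visible !inE. Qed.

Lemma sub_visible (R : realType) (J : {fset job}) (t : R) : visible J t `<=` J.
Proof. by apply/fsubsetP => j; rewrite mem_visible => /andP[]. Qed.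

Lemma visible_mono (R : realType) (J : {fset job}) (s t : R) :
  s <= t -> visible J s `<=` visible J t.
Proof.
move=> st; apply/fsubsetP => j; rewrite !mem_visible => /andP[-> /=].
by move=> /le_trans; apply.
Qed.

Lemma visible_visible (R : realType) (J : {fset job}) (s t : R) :
  visible (visible J t) s = visible J (Order.min s t).
Proof.
by apply/fsetP => j; rewrite !mem_visible -andbA le_min [_ && (_ <= s)]andbC.
Qed.

(** * Schedules, feasibility and the optimum *)

(* Every condition in [feasible] depends on the schedule only through [runs]. *)
Section Runs.
Variables (R : realType) (v : variant).
Implicit Types (S : schedule R) (j : job) (J : {fset job}).

Lemma runsE S j : [set t | Some j \in S t] = \bigcup_i runs S j i.
Proof.
apply/seteqP; split=> t /= => [/(nthP None)[i _ ij]|[i _]]; first by exists i.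
rewrite /runs /= => ij; have [it|it] := ltnP i (size (S t)).
  by rewrite -ij mem_nth.
by rewrite nth_default in ij.
Qed.

Lemma processed_ext S S' j :
  (forall i, runs S j i = runs S' j i) -> processed v S j -> processed v S' j.
Proof.
move=> E; case: v => /=.
  case=> mS; rewrite runsE => muS; split; first by move=> i; rewrite -E.
  by rewrite runsE -muS; congr lebesgue_measure; apply: eq_bigcup => // i _.
by case=> i [s [Ei Ei']]; exists i, s; split=> [|i']; rewrite -E //; exact: Ei'.
Qed.

Lemma feasible_ext J S S' :
  (forall t i, nth None (S t) i = nth None (S' t) i) ->
  feasible v J S -> feasible v J S'.
Proof.
move=> E; have {}E j i : runs S j i = runs S' j i.
  by apply/seteqP; split=> t; rewrite /runs /= E.
case=> H1 H2 H3; split=> [t i j|t i i' j|j jJ]; rewrite -?E.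
- exact: H1.
- exact: H2.
- by apply: processed_ext (H3 _ jJ) => i; exact: E.
Qed.

(** Letting a machine idle whenever it would process a job outside [J'] keeps the number of machines
    and does not affect the jobs of [J']. *)
Lemma schedulable_sub J J' k :
  J' `<=` J -> schedulable R v J k -> schedulable R v J' k.
Proof.
move=> /fsubsetP sJ [S [H1 H2 H3] Sk].
pose keep (o : option job) := if o is Some j then if j \in J' then o else None
  else None.
exists (fun t => map keep (S t)); last by move=> t; rewrite size_map.
have E j i : runs (fun t => map keep (S t)) j i =
    if j \in J' then runs S j i else set0.
  have nthE t : nth None (map keep (S t)) i = keep (nth None (S t) i).
    have [it|it] := ltnP i (size (S t)); first exact: nth_map.
    by rewrite !nth_default ?size_map.
  rewrite /runs; case: ifPn => jJ'; apply/seteqP; split=> t //=; rewrite nthE.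
  - by case: (nth _ _ _) => //= j'; case: ifP.
  - by move=> -> /=; rewrite jJ'.
  - case: (nth _ _ _) => //= j'; case: ifPn => // j'J' [jj'].
    by rewrite -jj' j'J' in jJ'.
split=> [t i j|t i i' j|j jJ'].
- by rewrite E; case: ifP => // jJ' /H1[].
- by rewrite !E; case: ifP => // _; exact: H2.
- by apply: processed_ext (H3 j (sJ _ jJ')) => i; rewrite E jJ'.
Qed.

Lemma schedulable_opt J :
  (exists k, schedulable R v J k) -> schedulable R v J (opt R v J).
Proof.
move=> [k Jk]; rewrite /opt; case: leastP => [n /asboolP //|/(_ k)].
by move=> /asboolPn /(_ Jk).
Qed.

Lemma opt_le J k : schedulable R v J k -> (opt R v J <= k)%N.
Proof.
move=> Jk; rewrite /opt; case: leastP => [n _|/(_ k)]; first by apply; exact/asboolP.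
by move=> /asboolPn /(_ Jk).
Qed.

Lemma opt_sub J J' :
  (exists k, schedulable R v J k) -> J' `<=` J -> (opt R v J' <= opt R v J)%N.
Proof.
by move=> exJ sJ; apply/opt_le/(schedulable_sub sJ)/schedulable_opt.
Qed.

(** * Padding an instance with unit jobs *)

(** The window is exactly as long as the job, which leaves no slack; the index [a] makes the copies
    distinct. *)
Definition unit_job (T a : nat) : job := Job a T 1 T.+1.

Definition unit_jobs (T M : nat) : {fset job} :=
  [fset unit_job T a | a in iota 0 M].

Lemma unit_jobsP T M j :
  reflect (exists2 a, (a < M)%N & j = unit_job T a) (j \in unit_jobs T M).
Proof.
apply: (iffP (imfsetP _ _ _ _)) => -[a aM ->]; exists a => //;
  by move: aM; rewrite /= mem_iota.
Qed.

Lemma unit_job_inj T : injective (unit_job T).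
Proof. by move=> a b []. Qed.

(** Each of the [M] jobs needs measure 1 inside the window from [T] to [T.+1], hence runs at almost
    every time of it. The exceptional sets together are still null and cannot cover the window, so
    at some time all [M] jobs run at once. *)
Lemma unit_jobs_simultaneous T M J S :
  unit_jobs T M `<=` J -> feasible v J S ->
  exists t, forall a, (a < M)%N -> Some (unit_job T a) \in S t.
Proof.
move=> /fsubsetP sJ [H1 _ H3].
pose I := `[(T%:R : R), (T.+1)%:R]%classic.
pose E a : set R := [set t | Some (unit_job T a) \in S t].
have EI a : (a < M)%N -> (E a `<=` I)%classic.
  move=> aM t; rewrite /E runsE => -[i _ /H1[_ /= l u]].
  by rewrite /I /= in_itv /= l u.
have uJ a : (a < M)%N -> unit_job T a \in J.
  by move=> aM; apply: sJ; apply/unit_jobsP; exists a.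
have P a : (a < M)%N -> measurable (E a) /\ lebesgue_measure (E a) = 1%E.
  move=> aM; move: (H3 _ (uJ _ aM)); case: v => /=.
    case=> mr ->; split=> //; rewrite /E runsE.
    by apply: bigcup_measurable => i _; exact: mr.
  case=> i [s [Ei Ei']].
  have -> : E a = `[s, s + 1%:R[%classic.
    rewrite /E runsE -[1%:R]/((processing (unit_job T a))%:R) -Ei.
    apply/seteqP; split=> [t [i' _]|t it]; last by exists i.
    by have [-> //|/Ei' ->] := eqVneq i' i.
  split; first exact: measurable_itv.
  rewrite lebesgue_measure_itv /= lte_fin ltrDl ltr01 -EFinD.
  by congr EFin; rewrite addrAC subrr add0r.
have muI : lebesgue_measure I = 1%E.
  rewrite lebesgue_measure_itv /= lte_fin ltr_nat ltnSn -EFinD.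
  by congr EFin; rewrite -natr1 addrAC subrr add0r.
have mI : measurable I by exact: measurable_itv.
(* The family is extended by empty sets to all naturals, to fit a countable union of negligible
   sets. *)
have nI a : (@lebesgue_measure R).-negligible
    (if (a < M)%N then (I `\` E a)%classic else set0).
  case: ifPn => aM; last exact: negligible_set0.
  have [mE muE] := P _ aM.
  exists ((I `\` E a)%classic); split=> //; first exact: measurableD.
  rewrite measureD //=; last by rewrite muI ltry.
  by rewrite (setIidr (EI _ aM)) muI muE subee.
have nU := negligible_bigcup nI.
have [t It nt] : exists2 t, I t &
    ~ (\bigcup_a (if (a < M)%N then (I `\` E a)%classic else set0)) t.
  apply: contrapT => /forall2NP H.
  have I0 : lebesgue_measure I = 0%E.
    refine (@measure_negligible _ _ _ (@lebesgue_measure R) _ mI _).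
    by apply: negligibleS nU => t It; have [/(_ It)|/contrapT] := H t.
  by move: muI; rewrite I0 => /esym/eqP; rewrite onee_eq0.
exists t => a aM; apply: contrapT => nEt; apply: nt; exists a => //.
by rewrite aM; split.
Qed.

(** At a time when all unit jobs run, the schedule lists [M] distinct entries, so it has at least
    [M] machines. *)
Lemma opt_unit_jobs T M J :
  unit_jobs T M `<=` J -> (exists k, schedulable R v J k) ->
  (M <= opt R v J)%N.
Proof.
move=> sJ /schedulable_opt[S feaS] Sk.
have [t tM] := unit_jobs_simultaneous sJ feaS.
apply: leq_trans (Sk t); rewrite -[M in (M <= _)%N](size_iota 0).
rewrite -(size_map (fun a => Some (unit_job T a))).
apply: uniq_leq_size.
  by rewrite map_inj_uniq ?iota_uniq // => a b [].
by move=> o /mapP[a]; rewrite mem_iota => aM ->; exact: tM.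
Qed.

(** All deadlines of [J] lie before [T], so the [M] machines are free from [T] on, and machine [a]
    can take the unit job [a] for one time unit. *)
Lemma schedulable_pad T M J :
  (forall j, j \in J -> (deadline j < T)%N) ->
  schedulable R v J M -> schedulable R v (J `|` unit_jobs T M) M.
Proof.
move=> dT [S [H1 H2 H3] SM].
pose S' (t : R) := if t < T%:R then S t else
  if t < T.+1%:R then mkseq (fun a => Some (unit_job T a)) M else [::].
exists S'; last first.
  by move=> t; rewrite /S'; case: ifP => // _; case: ifP; rewrite ?size_mkseq.
have U j t i : T%:R <= t -> runs S' j i t ->
    [/\ t < T.+1%:R, (i < M)%N & j = unit_job T i].
  rewrite /runs /S' /= leNgt => /negbTE ->; case: ifP => _; last by rewrite nth_nil.
  have [iM|iM] := ltnP i M; first by rewrite nth_mkseq // => -[].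
  by rewrite nth_default // size_mkseq.
have L j t i : t < T%:R -> runs S' j i t = runs S j i t.
  by rewrite /runs /S' /= => ->.
have late t i j : T%:R <= t -> ~ runs S j i t.
  move=> Tt /H1[jJ _ td]; have := le_trans Tt td.
  by rewrite ler_nat leqNgt dT.
have unit_notin i : unit_job T i \notin J.
  by apply/negP => /dT /=; rewrite ltnNge leqnSn.
have RJ j i : j \in J -> runs S' j i = runs S j i.
  move=> jJ; apply/seteqP; split=> t.
    have [tT|Tt] := ltP t T%:R; first by rewrite L.
    by case/(U _ _ _ Tt) => _ _ E; have := unit_notin i; rewrite -E jJ.
  have [tT|Tt] := ltP t T%:R; first by rewrite L.
  by move/(late _ _ _ Tt).
split=> [t i j|t i i' j|j].
- have [tT|Tt] := ltP t T%:R.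
    by rewrite L // => /H1[jJ rt td]; split=> //; rewrite inE jJ.
  case/(U _ _ _ Tt) => tT1 iM ->; split=> //; last exact: ltW.
  by rewrite inE; apply/orP; right; apply/unit_jobsP; exists i.
- have [tT|Tt] := ltP t T%:R; first by rewrite !L //; exact: H2.
  by case/(U _ _ _ Tt) => _ _ -> /(U _ _ _ Tt)[_ _ /unit_job_inj].
- rewrite inE => /orP[jJ|/unit_jobsP[a aM ->]].
    by apply: processed_ext (H3 _ jJ) => i; rewrite RJ.
  have Ra i : runs S' (unit_job T a) i =
      if i == a then `[T%:R, T.+1%:R[%classic else set0.
    apply/seteqP; split=> t.
      have [tT|Tt] := ltP t T%:R.
        by rewrite L // => /H1[]; rewrite (negbTE (unit_notin _)).
      case/(U _ _ _ Tt) => tT1 iM /unit_job_inj->; rewrite eqxx /=.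
      by rewrite in_itv /= Tt.
    case: eqP => // -> /=; rewrite in_itv /= => /andP[Tt tT1].
    by rewrite /runs /S' /= ltNge Tt /= tT1 nth_mkseq.
  case: v => /=.
    split=> [i|]; first by rewrite Ra; case: ifP => // _; exact: measurable_itv.
    rewrite runsE (_ : \bigcup_i _ = `[T%:R, T.+1%:R[%classic).
      rewrite lebesgue_measure_itv /= lte_fin ltr_nat ltnSn -EFinD.
      by congr EFin; rewrite -natr1 addrAC subrr add0r.
    apply/seteqP; split=> [t [i _]|t tI]; first by rewrite Ra; case: ifP.
    by exists a => //; rewrite Ra eqxx.
  exists a, T%:R; rewrite Ra eqxx; split; first by rewrite natr1.
  by move=> i' /negbTE ia; rewrite Ra ia.
Qed.

End Runs.

(** * The subroutine when told an upper bound on the optimum *)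

Section Padding.
Variables (R : realType) (v : variant) (c : R) (A : nat -> algorithm R).
Hypothesis compA : semi_online_competitive v c A.

(* [A] is only known to work when told the exact optimum. Unit jobs added in a
   far future window raise the optimum to [M], and before that window [A] cannot
   distinguish the padded instance from [K]. *)
Lemma semi_online_upper_bound (K : {fset job}) (M : nat) :
  schedulable R v K M ->
  feasible v K (run (A M) K) /\
  forall t, (size (run (A M) K t))%:R <= c * M%:R.
Proof.
move=> KM.
pose D := (\max_(j <- K) deadline j).+1.
have dD j : j \in K -> (deadline j < D)%N.
  by move=> jK; rewrite ltnS; apply: (@leq_bigmax_seq _ _ predT deadline).
pose P T := (K `|` unit_jobs T M)%fset.
have PM (T : nat) : (D <= T)%N -> schedulable R v (P T) M.
  by move=> DT; apply: schedulable_pad KM => j /dD jD; exact: leq_trans DT.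
have optP T : (D <= T)%N -> opt R v (P T) = M.
  move=> DT; apply/eqP; rewrite eqn_leq opt_le /=; last exact: PM.
  apply: (@opt_unit_jobs _ _ T); first exact: fsubsetUr.
  by exists M; exact: (PM T).
have suc T : (D <= T)%N -> succeeds v c (A M) (P T).
  by move=> DT; rewrite -{1}(optP T DT); apply: compA; exists M; exact: (PM T).
have runE T (t : R) : t < T%:R -> run (A M) (P T) t = run (A M) K t.
  move=> tT; rewrite /run; congr (A M _ t); apply/fsetP => j.
  rewrite !mem_visible inE; case: (j \in K) => //=.
  by apply/negP => /andP[/unit_jobsP[a _ ->] /=]; rewrite leNgt tT.
(* Feasibility constrains the run on [K] at all times, also after [D]; so for each [t] the padding
   is moved beyond [t]. *)
have far (t : R) : exists2 T, (D <= T)%N & t < T%:R.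
  exists (maxn D (Num.truncn t).+1); first exact: leq_maxl.
  by apply: lt_le_trans (truncnS_gt t) _; rewrite ler_nat leq_maxr.
have runsE T j i t : t < T%:R ->
    runs (run (A M) (P T)) j i t = runs (run (A M) K) j i t.
  by move=> tT; rewrite /runs /= runE.
have H1 t i j : runs (run (A M) K) j i t ->
    [/\ j \in K, (release j)%:R <= t & t <= (deadline j)%:R].
  have [T DT tT] := far t; rewrite -(runsE T) //.
  have [[F1 _ _] _] := suc T DT; move=> /F1[]; rewrite inE.
  by move=> /orP[//|/unit_jobsP[a _ ->] /=]; rewrite leNgt tT.
split; last first.
  move=> t; have [T DT tT] := far t; rewrite -(runE T) //.
  by have [_ /(_ t)] := suc T DT; rewrite optP.
split=> // [t i i' j|j jK].
  have [T DT tT] := far t; rewrite -!(runsE T) //.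
  by have [[_ F2 _] _] := suc T DT; exact: F2.
(* The processing condition involves all times at once and needs a single padded instance. [T = D]
   suffices, since both runs process [j] only up to its deadline, which is before [D]. *)
have [[F1 _ F3] _] := suc D (leqnn _).
have jP : j \in P D by rewrite inE jK.
apply: processed_ext (F3 _ jP) => i; apply/seteqP; split=> t.
- move=> r; rewrite -(runsE D) //.
  by case/F1: r => _ _ /le_lt_trans; apply; rewrite ltr_nat dD.
- move=> r; rewrite (runsE D) //.
  by case/H1: r => _ _ /le_lt_trans; apply; rewrite ltr_nat dD.
Qed.

End Padding.

(** * Restart times and phases *)

Section Restarts.
Variables (R : realType) (v : variant).
Implicit Types (J : {fset job}) (i s t : nat).

Let instance J := exists k, schedulable R v J k.

Lemma instance_visible J (x : R) : instance J -> instance (visible J x).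
Proof. by case=> k Jk; exists k; exact: schedulable_sub (sub_visible _ _) Jk. Qed.

Lemma opt_at_mono J s t :
  instance J -> (s <= t)%N -> (opt_at R v J s <= opt_at R v J t)%N.
Proof.
move=> exJ st; apply: opt_sub; first exact: instance_visible.
by apply: visible_mono; rewrite ler_nat.
Qed.

Lemma opt_at_le J s : instance J -> (opt_at R v J s <= opt R v J)%N.
Proof. by move=> exJ; apply: opt_sub => //; exact: sub_visible. Qed.

(** The optimum is monotone in time, so at or before [s] it cannot exceed twice its value at [s]. *)
Lemma restart_lt J i s s' : instance J ->
  restart R v J i = Some s -> restart R v J i.+1 = Some s' -> (s < s')%N.
Proof.
move=> exJ /= ->; case: leastP => // n Pn _ [<-].
rewrite ltnNge; apply/negP => ns.
by have := opt_at_mono exJ ns; lia.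
Qed.

Lemma restart_prev J i i' s' : instance J -> (i < i')%N ->
  restart R v J i' = Some s' ->
  exists2 s, restart R v J i = Some s & (s < s')%N.
Proof.
move=> exJ; elim: i' s' => // i' IH s' ii' E.
case E' : (restart R v J i') => [s|]; last by rewrite /= E' in E.
have ss' := restart_lt exJ E' E.
move: ii'; rewrite ltnS leq_eqVlt => /predU1P[->|/IH/(_ E')[s0 E0 s0s]].
  by exists s.
by exists s0 => //; exact: ltn_trans ss'.
Qed.

(** The visible set changes only at release dates: if no job were released at a later restart [s],
    the optimum would already be too large at [s.-1], against minimality. *)
Lemma restart_release J i s : instance J ->
  restart R v J i = Some s -> exists2 j, j \in J & release j = s.
Proof.
move=> exJ; case: i => [|i].
  by move=> /=; case: leastP => // n /imfsetP[j /= jJ ->] _ [<-]; exists j.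
case Ei : (restart R v J i) => [s0|]; last by rewrite /= Ei.
move=> Es; have s0s := restart_lt exJ Ei Es; move: Es.
rewrite /= Ei; case: leastP => // n Pn minn [ns]; subst n.
apply: contrapT => noj; have /minn : (2 * opt_at R v J s0 < opt_at R v J s.-1)%N.
  rewrite (_ : opt_at R v J s.-1 = opt_at R v J s) //.
  congr opt; apply/fsetP => j; rewrite !mem_visible; case jJ : (j \in J) => //=.
  rewrite !ler_nat; have : release j <> s by move=> E; apply: noj; exists j.
  by lia.
by lia.
Qed.

(** The restarts [0] to [i] have distinct times, all of them release dates. Hence the number of
    groups that [Double] enumerates covers all restarts. *)
Lemma restart_card J i s : instance J ->
  restart R v J i = Some s -> (i < #|` J|)%N.
Proof.
(* The default 0 never occurs here: all restarts up to index [i] exist. *)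
move=> exJ Es; pose time k := odflt 0%N (restart R v J k).
apply: leq_trans (leq_imfset_card imfset_key release (mem J)).
rewrite -[i.+1](size_iota 0) -(size_map time); apply: uniq_leq_size.
  have lt k k' : (k < k' < i.+1)%N -> (time k < time k')%N.
    move=> /andP[kk' k'i]; have [s' Es'] : exists s', restart R v J k' = Some s'.
      move: k'i; rewrite ltnS leq_eqVlt => /predU1P[->|k'i]; first by exists s.
      by have [s' ? _] := restart_prev exJ k'i Es; exists s'.
    by have [s0 Es0 s0s] := restart_prev exJ kk' Es'; rewrite /time Es0 Es'.
  rewrite map_inj_in_uniq ?iota_uniq // => k k'; rewrite !mem_iota /= => ki k'i.
  have [kk'|kk'|//] := ltngtP k k' => E.
    by have := lt k k'; rewrite E ltnn kk' k'i => /(_ isT).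
  by have := lt k' k; rewrite E ltnn kk' ki => /(_ isT).
move=> n /mapP[k]; rewrite mem_iota /= ltnS leq_eqVlt => ki ->.
have [s' Es'] : exists s', restart R v J k = Some s'.
  case/predU1P: ki => [->|ki]; first by exists s.
  by have [s' ? _] := restart_prev exJ ki Es; exists s'.
have [j jJ rj] := restart_release exJ Es'.
have -> : time k = release j by rewrite /time Es' rj.
by apply/imfsetP; exists j.
Qed.

Lemma opt_at_visible J (x : R) s :
  s%:R <= x -> opt_at R v (visible J x) s = opt_at R v J s.
Proof. by move=> sx; rewrite /opt_at visible_visible min_l. Qed.

Lemma opt_at_visible_le J (x : R) s :
  instance J -> (opt_at R v (visible J x) s <= opt_at R v J s)%N.
Proof.
move=> exJ; rewrite /opt_at visible_visible; apply: opt_sub.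
  exact: instance_visible.
by apply: visible_mono; rewrite ge_min lexx.
Qed.

(** This makes the restarts computable online. Up to time [x] the visible jobs yield the same optima
    as [J]; after [x] their optimum stays constant, so no spurious restart appears. *)
Lemma restart_visible J (x : R) i : instance J ->
  restart R v (visible J x) i =
  if restart R v J i is Some s then (if s%:R <= x then Some s else None)
  else None.
Proof.
move=> exJ; elim: i => [|i IH].
  case E : (restart R v J 0) => [n|]; move: E; rewrite [restart R v J 0]/=.
    case: leastP => // _ /imfsetP[j /= jJ ->] minn [<-]; case: ifP => jx.
      apply: least_eq => [|m /imfsetP[j' /=]].
        by apply/imfsetP; exists j => //=; rewrite mem_visible jJ.
      by rewrite mem_visible => /andP[j'J _] ->; apply/minn/imfsetP; exists j'.
    apply: least_none => m; apply/imfsetP => -[j' /=].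
    rewrite mem_visible => /andP[j'J j'x] _; move: jx => /negP; apply.
    apply: le_trans j'x; rewrite ler_nat.
    by apply/minn/imfsetP; exists j'.
  case: leastP => //= none _; apply: least_none => m; apply/imfsetP => -[j' /=].
  rewrite mem_visible => /andP[j'J _] _; have /negP := none (release j'); apply.
  by apply/imfsetP; exists j'.
case Ei : (restart R v J i) => [s|]; last by rewrite /= IH Ei.
have [sx|xs] := leP s%:R x; last first.
  case Ei' : (restart R v J i.+1) => [s'|]; last first.
    by rewrite /= IH Ei leNgt xs.
  have ss' := restart_lt exJ Ei Ei'.
  rewrite ifF; first by rewrite /= IH Ei leNgt xs.
  by apply/negbTE; rewrite -ltNge (lt_trans xs) ?ltr_nat.
case E : (restart R v J i.+1) => [n|]; move: E; rewrite [restart R v J i.+1]/= Ei.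
  case: leastP => // n' Pn minn [nn']; subst n'; rewrite /= IH Ei sx opt_at_visible //.
  case: ifP => nx.
    apply: least_eq; first by rewrite opt_at_visible.
    by move=> m Pm; apply: minn; apply: leq_trans Pm (opt_at_visible_le _ _ _).
  apply: least_none => m; apply/negP => Pm; move: nx => /negP; apply.
  have x0 : 0 <= x by apply: le_trans sx.
  (* Release dates are integers, so the jobs visible at [x] are those visible at [Num.truncn x]. A
     spurious restart would thus force [n] to be at most [x]. *)
  have /minn nt : (2 * opt_at R v J s < opt_at R v J (Num.truncn x))%N.
    apply: leq_trans Pm _; apply: opt_sub; first exact: instance_visible.
    rewrite visible_visible; apply/fsubsetP => j.
    rewrite !mem_visible le_min => /and3P[-> _ jx] /=.
    by rewrite ler_nat truncn_ge_nat.
  by rewrite -(truncn_ge_nat n x0).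
case: leastP => // none _; rewrite /= IH Ei sx opt_at_visible //.
apply: least_none => m; apply/negP => Pm; have /negP := none m; apply.
exact: leq_trans Pm (opt_at_visible_le _ _ _).
Qed.

Lemma mem_phase_jobs J i j :
  (j \in phase_jobs R v J i) =
  if restart R v J i is Some s then
    [&& j \in J, (s <= release j)%N &
      if restart R v J i.+1 is Some s' then (release j < s')%N else true]
  else false.
Proof. by rewrite /phase_jobs; case: (restart R v J i) => [s|]; rewrite !inE. Qed.

(** If the next restart lies after [x], it is not yet known at time [x], but then every visible job
    is released before it anyway. *)
Lemma phase_jobs_visible J (x : R) i s : instance J ->
  restart R v J i = Some s -> s%:R <= x ->
  phase_jobs R v (visible J x) i = visible (phase_jobs R v J i) x.
Proof.
move=> exJ Ei sx; apply/fsetP => j.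
rewrite mem_visible !mem_phase_jobs !restart_visible // Ei sx mem_visible.
case: (j \in J); last by [].
case: (s <= release j)%N; last by rewrite andbF.
case Ei' : (restart R v J i.+1) => [s'|]; last by rewrite /= andbC.
have [s'x|xs'] := leP s'%:R x; first by rewrite /= andbC.
rewrite /= andbT; case: leP => jx; rewrite ?andbF // andbT.
by symmetry; rewrite -(ltr_nat R); exact: le_lt_trans xs'.
Qed.

(** Jobs of the earlier phase are released before its next restart, which is no later than the start
    of the later phase. *)
Lemma phase_jobs_inj J i i' j : instance J ->
  j \in phase_jobs R v J i -> j \in phase_jobs R v J i' -> i = i'.
Proof.
move=> exJ; wlog ii' : i i' / (i < i')%N.
  by move=> W ji ji'; have [/W|/W|//] := ltngtP i i'; [exact | move/(_ ji' ji)].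
rewrite !mem_phase_jobs; case: (restart R v J i) => // s /and3P[_ _ js].
case Ei' : (restart R v J i') => [s'|//] /and3P[_ s'j _].
suff [s1 Es1 s1s'] : exists2 s1, restart R v J i.+1 = Some s1 & (s1 <= s')%N.
  by move: js; rewrite Es1; lia.
move: ii'; rewrite leq_eqVlt => /predU1P[->|ii']; first by exists s'.
by have [s1 Es1 s1s'] := restart_prev exJ ii' Ei'; exists s1 => //; exact: ltnW.
Qed.

(** The phase of [j] is the last one starting no later than its release date; one exists because the
    first restart is the least release date. *)
Lemma phase_jobs_cover J j : instance J -> j \in J ->
  exists2 i, (i < #|` J|)%N & j \in phase_jobs R v J i.
Proof.
move=> exJ jJ.
pose P i := if restart R v J i is Some s then (s <= release j)%N else false.
have P0 : P 0%N.
  rewrite /P /=; case: leastP => [n _|/(_ (release j))/negP[]].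
    by apply; apply/imfsetP; exists j.
  by apply/imfsetP; exists j.
have Pcard i : P i -> (i <= #|` J|)%N.
  rewrite /P; case Ei : restart => [s|//] _.
  exact/ltnW/(restart_card exJ Ei).
case: (ex_maxnP (ex_intro P _ P0) Pcard) => i Pi maxi.
have nPi1 : ~~ P i.+1 by apply/negP => /maxi; rewrite ltnn.
exists i; rewrite ?mem_phase_jobs; move: Pi nPi1; rewrite /P;
  case Ei : (restart R v J i) => [s|//] sj.
  by rewrite (restart_card exJ Ei).
by rewrite jJ sj; case: (restart R v J i.+1) => // s'; rewrite -ltnNge.
Qed.

Lemma phase_jobs_sub J i : (phase_jobs R v J i `<=` J)%fset.
Proof.
apply/fsubsetP => j; rewrite mem_phase_jobs.
by case: restart => // s /and3P[].
Qed.

Lemma schedulable_le J k k' :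
  (k <= k')%N -> schedulable R v J k -> schedulable R v J k'.
Proof.
by move=> kk' [S fS Sk]; exists S => // t; exact: leq_trans kk'.
Qed.

Lemma schedulable_phase_jobs J i s : instance J ->
  restart R v J i = Some s ->
  schedulable R v (phase_jobs R v J i) (2 * opt_at R v J s).
Proof.
move=> exJ Ei.
(* The last integer time before the next restart or, if there is none, a time at which all of [J] is
   visible. In both cases the optimum has not yet exceeded the threshold. *)
pose T := if restart R v J i.+1 is Some s' then s'.-1
          else (\max_(j <- J) release j)%N.
have le2 : (opt_at R v J T <= 2 * opt_at R v J s)%N.
  rewrite /T; case Ei' : (restart R v J i.+1) => [s'|]; last first.
    move: Ei'; rewrite /= Ei; case: leastP => // none _.
    by rewrite leqNgt; exact: none.
  have ss' := restart_lt exJ Ei Ei'; move: Ei'.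
  rewrite /= Ei; case: leastP => // n _ minn [ns]; subst n.
  by rewrite leqNgt; apply/negP => /minn; lia.
apply: schedulable_le le2 _.
apply: schedulable_sub (schedulable_opt (instance_visible T%:R exJ)).
apply/fsubsetP => j; rewrite mem_phase_jobs Ei mem_visible => /and3P[jJ _ js].
rewrite jJ ler_nat /T; case: restart js => [s'|_]; first by lia.
exact: (@leq_bigmax_seq _ _ predT release).
Qed.

(* The optima at successive restarts more than double, so their sum is dominated
   by twice the last one. *)
Lemma sum_opt_at_restart J n : instance J ->
  (\sum_(i < n) (if restart R v J i is Some s then opt_at R v J s else 0) <=
   2 * opt R v J)%N.
Proof.
move=> exJ; pose w i := if restart R v J i is Some s then opt_at R v J s else 0%N.
have wS i : restart R v J i.+1 != None -> (2 * w i < w i.+1)%N.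
  rewrite /w; case Ei' : (restart R v J i.+1) => [s'|] // _; move: Ei' => /=.
  by case: (restart R v J i) => // s; case: leastP => // n' Pn' _ [<-].
have sumw i : restart R v J i != None -> (\sum_(k < i.+1) w k <= 2 * w i)%N.
  elim: i => [|i IH] Ei; first by rewrite big_ord1 leq_pmull.
  have Ei0 : restart R v J i != None.
    by apply: contraNneq Ei => /= ->.
  rewrite big_ord_recr; apply: leq_trans (leq_add (IH Ei0) (leqnn _)) _.
  (* The earlier terms sum to at most [2 * w i], which is below [w i.+1]. *)
  by rewrite [leqRHS]mul2n -addnn leq_add2r; exact/ltnW/wS.
elim: n => [|n IH]; first by rewrite big_ord0.
have [En|En] := eqVneq (restart R v J n) None.
  by rewrite big_ord_recr /= En addn0.
apply: leq_trans (sumw n En) _; rewrite leq_pmul2l // /w.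
by case: (restart R v J n) => // s; exact: opt_at_le.
Qed.

End Restarts.

(** * Running schedules side by side on disjoint machines *)

Section Combination.
Variables (R : realType) (v : variant).

(** Since the group sizes do not depend on time, machine [x] of the concatenation is at all times
    machine [o x] of group [r x]. A job belongs to one group only, so its runs are those in that
    group. *)
Lemma feasible_flatten (N : nat) (n : nat -> nat) (K : nat -> {fset job})
    (S : nat -> schedule R) (J : {fset job}) :
  (forall i t, (i < N)%N -> size (S i t) = n i) ->
  (forall i, (i < N)%N -> feasible v (K i) (S i)) ->
  (forall i i' j, j \in K i -> j \in K i' -> i = i') ->
  (forall j, (j \in J) <-> exists2 i, (i < N)%N & j \in K i) ->
  feasible v J (fun t => flatten (mkseq (S^~ t) N)).
Proof.
move=> sizeS feaS disjK defJ; set F := fun t => _.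
pose sh := mkseq n N.
pose r := reshape_index sh; pose o := reshape_offset sh.
have shapeF t : shape (mkseq (S^~ t) N) = sh.
  rewrite /shape /sh /mkseq -map_comp; apply/eq_in_map => i.
  by rewrite mem_iota => iN; exact: sizeS.
have runsF j x : runs F j x = if (r x < N)%N then runs (S (r x)) j (o x) else set0.
  apply/seteqP; split=> t; rewrite /runs /F /= nth_flatten shapeF -/(r x) -/(o x).
    case: ifPn => [rN|rN]; first by rewrite nth_mkseq.
    by rewrite [nth _ (mkseq _ _) _]nth_default ?nth_nil // size_mkseq leqNgt.
  by case: ifPn => // rN; rewrite nth_mkseq.
have runsK j x t : runs F j x t -> [/\ (r x < N)%N, j \in K (r x) &
    runs (S (r x)) j (o x) t].
  rewrite runsF; case: ifP => // rN h; split=> //.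
  by have [F1 _ _] := feaS _ rN; case/F1: h.
split=> [t x j|t x x' j|j].
- move=> /runsK[rN jK rx]; have [F1 _ _] := feaS _ rN.
  by have [_ ? ?] := F1 _ _ _ rx; split=> //; apply/defJ; exists (r x).
- move=> /runsK[rN jK rx] /runsK[_ jK' rx'].
  have E := disjK _ _ _ jK jK'; rewrite -E in rx'.
  have [_ F2 _] := feaS _ rN; have E' := F2 _ _ _ _ rx rx'.
  by rewrite -(reshape_indexK sh x) -(reshape_indexK sh x') -/(r x) -/(o x) E E'.
move=> /defJ[i iN jK].
have [_ _ /(_ j jK) Pj] := feaS i iN.
have runs_other x : r x != i -> runs F j x = set0.
  move=> rxi; apply/seteqP; split=> // t /runsK[_ /(disjK _ _ _ jK) E _].
  by rewrite E eqxx in rxi.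
have runs_big y : (n i <= y)%N -> runs (S i) j y = set0.
  move=> niy; apply/seteqP; split=> // t.
  by rewrite /runs /= nth_default // sizeS.
have flatK y : (y < n i)%N ->
    r (flatten_index sh i y) = i /\ o (flatten_index sh i y) = y.
  move=> yn; have yn' : (y < nth 0 sh i)%N by rewrite nth_mkseq.
  by split; [exact: flatten_indexKl | exact: flatten_indexKr].
have runs_flat y : (y < n i)%N -> runs F j (flatten_index sh i y) = runs (S i) j y.
  by move=> /flatK[rE oE]; rewrite runsF rE oE iN.
case: v Pj => /= [[mr mu]|[y [s [Ey Ey']]]].
  split=> [x|].
    have [rx|/runs_other ->//] := eqVneq (r x) i.
    by rewrite runsF rx iN.
  rewrite -mu !runsE; congr lebesgue_measure.
  apply/seteqP; split=> t [x _].
    move=> h; have [_ /(disjK _ _ _ jK) E rx] := runsK _ _ _ h.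
    by rewrite -E in rx; exists (o x).
  have [xn|/runs_big ->//] := ltnP x (n i).
  by exists (flatten_index sh i x) => //; rewrite runs_flat.
have [yn|yn] := ltnP y (n i).
  exists (flatten_index sh i y), s; rewrite runs_flat //; split=> // x xi.
  have [rx|/runs_other//] := eqVneq (r x) i.
  rewrite runsF rx iN; apply: Ey'; apply: contraNneq xi => <-.
  by rewrite -rx reshape_indexK.
(* The machine [y] lies outside the group, so the processing interval is empty and any machine can
   serve as witness. *)
exists 0%N, s; rewrite -Ey (runs_big _ yn).
have no x : runs F j x = set0.
  have [rx|/runs_other//] := eqVneq (r x) i.
  rewrite runsF rx iN; have [->|/Ey'//] := eqVneq (o x) y; exact: runs_big.
by split=> [|x _]; exact: no.
Qed.

End Combination.

Lemma flatten_mkseq_cat (T : Type) (f : nat -> seq T) (k m : nat) :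
  flatten (mkseq f (k + m)) =
  flatten (mkseq f k) ++ flatten [seq f i | i <- iota k m].
Proof. by rewrite /mkseq iotaD map_cat flatten_cat. Qed.

Lemma nth_mkseq_nth (T : Type) (x0 : T) (s : seq T) (n i : nat) :
  (size s <= n)%N -> nth x0 (mkseq (nth x0 s) n) i = nth x0 s i.
Proof.
move=> sn; have [i_n|n_i] := ltnP i n; first exact: nth_mkseq.
by rewrite !nth_default ?size_mkseq // (leq_trans sn).
Qed.

(** * Feasibility and machine count of [Double] *)

Section DoubleAnalysis.
Variables (R : realType) (v : variant) (alpha : R) (A : nat -> algorithm R).
Hypotheses (alpha_ge1 : 1 <= alpha) (compA : semi_online_competitive v alpha A).
Variable J : {fset job}.
Hypothesis exJ : exists k, schedulable R v J k.

(* The [i]-th group of machines, present (but idle) already before it is opened. *)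
Let group (i : nat) (t : R) : seq (option job) :=
  if restart R v J i is Some s then
    let M := (2 * opt_at R v J s)%N in
    mkseq (nth None (run (A M) (phase_jobs R v J i) t)) (Num.truncn (alpha * M%:R))
  else [::].

Let group_size (i : nat) : nat :=
  if restart R v J i is Some s then
    Num.truncn (alpha * (2 * opt_at R v J s)%:R)
  else 0%N.

Lemma size_group i t : size (group i t) = group_size i.
Proof.
by rewrite /group /group_size; case: restart => // s; rewrite size_mkseq.
Qed.

Lemma feasible_group i : feasible v (phase_jobs R v J i) (group i).
Proof.
rewrite /group; case Ei : (restart R v J i) => [s|]; last first.
  split=> [t k j|t k k' j|j]; rewrite /runs /= ?nth_nil //.
  by rewrite mem_phase_jobs Ei.
have [fK sK] := semi_online_upper_bound compA (schedulable_phase_jobs exJ Ei).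
(* A natural number bounded by [alpha * M] is bounded by its truncation, so limiting the group to
   that many machines cuts off nothing. *)
apply: feasible_ext fK => t k; rewrite nth_mkseq_nth //.
by rewrite truncn_ge_nat ?sK // mulr_ge0 // (le_trans ler01).
Qed.

(** Although only the jobs visible at [t] are used, an opened group acts as the offline [group]: its
    restart, the optimum there and the visible part of its phase can all be read off those jobs. *)
Lemma phase_machinesE t i :
  phase_machines v alpha A (visible J t) t i =
  if restart R v (visible J t) i is Some _ then group i t else [::].
Proof.
rewrite /phase_machines /group restart_visible //.
case Ei : (restart R v J i) => [s|//]; case: ifP => // st.
by rewrite (phase_jobs_visible _ Ei) // opt_at_visible.
Qed.

(** The jobs of a group that is not yet open at [t] are released after [t], and a feasible schedule
    cannot run them earlier. *)
Lemma group_idle t i k :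
  restart R v (visible J t) i = None -> nth None (group i t) k = None.
Proof.
move=> Ei; case E : nth => [j|] //; have [F1 _ _] := feasible_group i.
have [jK jt _] := F1 t k j E; move: Ei jK; rewrite mem_phase_jobs restart_visible //.
case: (restart R v J i) => // s; case: ifP => // /negP st _ /and3P[_ sj _].
by case: st; apply: le_trans jt; rewrite ler_nat.
Qed.

(** The two lists may differ in length but not in entries: open groups come first and agree, and
    what follows is empty on the left and idle on the right. *)
Lemma run_DoubleE t k :
  nth None (run (Double v alpha A) J t) k =
  nth None (flatten (mkseq (group^~ t) #|` J|)) k.
Proof.
have exK := instance_visible t exJ.
rewrite /run /Double; set K := visible J t; set N' := #|` K|.
have N'N : (N' <= #|` J|)%N by exact/fsubset_leq_card/sub_visible.
pose P i := restart R v K i == None.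
have PN' : P N'.
  rewrite /P; case E : restart => [s|] //.
  by have := restart_card exK E; rewrite ltnn.
(* Here [n] is the number of groups open at time [t]. *)
case: (ex_minnP (ex_intro P _ PN')) => n /eqP Pn minn.
have open i : (i < n)%N -> restart R v K i <> None.
  by move=> i_n /eqP /minn; rewrite leqNgt i_n.
have closed i : (n <= i)%N -> restart R v K i = None.
  rewrite leq_eqVlt => /predU1P[<-//|ni]; case E : (restart R v K i) => [s|] //.
  by have [s' Es'] := restart_prev exK ni E; rewrite Pn in Es'.
rewrite -(subnKC (minn _ PN')) -(subnKC (leq_trans (minn _ PN') N'N)).
rewrite !flatten_mkseq_cat.
have -> : mkseq (phase_machines v alpha A K t) n = mkseq (group^~ t) n.
  apply/eq_in_map => i; rewrite mem_iota => /open.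
  by rewrite phase_machinesE -/K; case: restart.
rewrite !nth_cat; case: ifP => // _; set k' := (k - _)%N.
have none ss : (forall s i, s \in ss -> nth None s i = None) ->
    nth None (flatten ss) k' = None :> option job.
  move=> h; rewrite nth_flatten; set s := nth [::] ss _.
  have [/(mem_nth [::])/h//|le] := ltnP (reshape_index (shape ss) k') (size ss).
  by rewrite /s (nth_default _ le) nth_nil.
rewrite !none // => s i /mapP[i']; rewrite mem_iota => /andP[/closed ni _] ->.
  exact: group_idle.
by rewrite phase_machinesE -/K ni nth_nil.
Qed.

Lemma size_run_Double t :
  (size (run (Double v alpha A) J t))%:R <= 4 * alpha * (opt R v J)%:R.
Proof.
have alpha_ge0 : 0 <= alpha by apply: le_trans alpha_ge1.
pose w i := if restart R v J i is Some s then opt_at R v J s else 0%N.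
have group_sizeP i : (group_size i)%:R <= alpha * (2 * w i)%:R.
  rewrite /group_size /w; case: restart => [s|]; last by rewrite muln0 mulr0.
  by rewrite -truncn_ge_nat // mulr_ge0.
have sizeP n : (size (flatten (mkseq
    (phase_machines v alpha A (visible J t) t) n)))%:R <=
    alpha * (2 * \sum_(i < n) w i)%:R.
  elim: n => [|n IH]; first by rewrite big_ord0 muln0 mulr0.
  rewrite -[n.+1]addn1 flatten_mkseq_cat size_cat /= cats0 addn1 big_ord_recr /=.
  rewrite mulnDr natrD [X in _ <= _ * X]natrD mulrDr; apply: lerD => //.
  apply: le_trans (group_sizeP n); rewrite phase_machinesE.
  by case: (restart R v (visible J t) n) => [s|//]; rewrite size_group.
(* One factor 2 comes from the value given to the subroutine, the other from the sum over the
   restarts. *)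
apply: le_trans (sizeP _) _; rewrite [4 * alpha]mulrC -mulrA ler_wpM2l //.
rewrite -natrM ler_nat (_ : 4 = 2 * 2)%N // -mulnA leq_mul2l /=.
exact: sum_opt_at_restart.
Qed.

Lemma Double_succeeds : succeeds v (4 * alpha) (Double v alpha A) J.
Proof.
split; last exact: size_run_Double.
apply: (@feasible_ext _ _ _ (fun t => flatten (mkseq (group^~ t) #|` J|))).
  by move=> t i; rewrite run_DoubleE.
apply: feasible_flatten => [i t _|i _|i i' j|j].
- exact: size_group.
- exact: feasible_group.
- exact: phase_jobs_inj.
- split=> [|[i _]]; first exact: phase_jobs_cover.
  exact/fsubsetP/phase_jobs_sub.
Qed.

End DoubleAnalysis.

Theorem theorem1 (R : realType) (v : variant) (alpha : R)
    (A : nat -> algorithm R) :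
  1 <= alpha ->
  semi_online_competitive v alpha A ->
  online_competitive v (4 * alpha) (Double v alpha A).
Proof. by move=> alpha_ge1 compA J exJ; exact: Double_succeeds. Qed.
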